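(* Let $X$ be a compact space. Then $X$ admits an $r$-skeleton if and only if $X$ admits a $\pi$-skeleton.
   Context: All spaces are Tychonoff. $[T]^{\le\omega}$ is the set of countable subsets of $T$, ordered by inclusion. A retraction in $X$ is a continuous map $r:X\to X$ with $r\circ r=r$. A space is cosmic if it has a countable network. A partially ordered set $\Gamma$ is up-directed if any two elements have a common upper bound, and $\sigma$-complete if every increasing sequence in $\Gamma$ has a supremum in $\Gamma$. An $r$-skeleton on a space $X$ is a family $\{r_s:s\in\Gamma\}$ of retractions in $X$, indexed by an up-directed $\sigma$-complete partially ordered set $\Gamma$, such that: (i) $r_s(X)$ is cosmic for each $s\in\Gamma$; (ii) $r_s=r_s\circ r_t=r_t\circ r_s$ whenever $s\le t$; (iii) if $\langle s_n\rangle_{n<\omega}\subseteq\Gamma$ is increasing and $s=\sup\{s_n:n<\omega\}$, then $r_s(x)=\lim_{n\to\infty}r_{s_n}(x)$ for each $x\in X$; (iv) $x=\lim_{s\in\Gamma}r_s(x)$ for each $x\in X$. For up-directed $\sigma$-complete partially ordered sets $\Gamma,\Gamma'$, a function $\psi:\Gamma\to\Gamma'$ is $\omega$-monotone if $\psi(s)\le\psi(t)$ whenever $s\le t$, and $\psi(\sup_{n<\omega}s_n)=\sup_{n<\omega}\psi(s_n)$ for every increasing sequence $\langle s_n\rangle_{n<\omega}\subseteq\Gamma$. Let $X\subseteq[0,1]^T$ be compact; for $A\subseteq T$, $\pi_A$ denotes the projection onto the coordinates in $A$. A family $\{F_s:s\in\Gamma\}$ of cosmic subspaces of $X$, indexed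 by an up-directed $\sigma$-complete partially ordered set $\Gamma$, and an $\omega$-monotone function $\psi:\Gamma\to[T]^{\le\omega}$ generate a $\pi$-skeleton on $X$ if: (a) $F_s\subseteq F_t$ whenever $s\le t$; (b) $\bigcup_{s\in\Gamma}F_s$ is dense in $X$; (c) for each $s\in\Gamma$, $\pi_{\psi(s)}\upharpoonright_{F_s}$ is a homeomorphism onto its image and $\pi_{\psi(s)}(X)=\pi_{\psi(s)}(F_s)$. A compact space admits a $\pi$-skeleton if for some set $T$ it has an embedded copy in $[0,1]^T$ on which there is a $\pi$-skeleton. *)

(* Defs.v *)
From HB Require Import structures.
From mathcomp Require Import all_boot all_order all_algebra.
From mathcomp Require Import all_classical all_reals all_analysis.
Import Order.TTheory GRing.Theory Num.Theory.
Import numFieldNormedType.Exports.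

Set Implicit Arguments.
Unset Strict Implicit.
Unset Printing Implicit Defensive.

Local Open Scope classical_set_scope.
Local Open Scope ring_scope.

Definition up_directed d (G : porderType d) : Prop :=
  forall s t : G, exists u : G, (s <= u)%O /\ (t <= u)%O.

Definition sigma_complete d (G : porderType d) : Prop :=
  forall u : nat -> G, nondecreasing_seq u -> exists s, supremums (range u) s.

(* As [nondecreasing_seq u] forces [psi \o u] to be nondecreasing, the second
   clause is psi (sup u) = sup (psi \o u); [supremums] has at most one element. *)
Definition omega_monotone d (G : porderType d) d' (G' : porderType d')
    (psi : G -> G') : Prop :=
  {homo psi : s t / (s <= t)%O} /\
  forall (u : nat -> G) (s : G), nondecreasing_seq u ->
    supremums (range u) s -> supremums (range (psi \o u)) (psi s).

(* The filter of tails of G: [f @ tails G --> x] is convergence of the net f.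
   If G is empty, no net indexed by G converges. *)
Definition tails d (G : porderType d) : set_system G :=
  filter_from setT (fun s0 : G => [set s | (s0 <= s)%O]).
Arguments tails {d} G.

Definition countable_sets (T : Type) : Type :=
  set_type [set A : set T | countable A].

HB.instance Definition _ (T : Type) := SubChoice.on (countable_sets T).
HB.instance Definition _ (T : Type) :=
  [SubChoice_isSubPOrder of countable_sets T by <: with set_display].

Definition network (Y : topologicalType) (N : set (set Y)) : Prop :=
  forall (y : Y) (U : set Y), open U -> U y ->
    exists2 B, N B & B y /\ B `<=` U.

Definition cosmic (Y : topologicalType) : Prop :=
  exists2 N : set (set Y), countable N & network N.

Definition homeomorphism (Y Z : topologicalType) (h : Y -> Z) : Prop :=
  continuous h /\
  exists g : Z -> Y, [/\ continuous g, cancel h g & cancel g h].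

Definition homeomorphism_onto_image (Y Z : topologicalType) (f : Y -> Z) :
    Prop :=
  exists h : Y -> set_type (range f),
    homeomorphism h /\ forall y, set_val (h y) = f y.

Definition retraction (X : topologicalType) (r : X -> X) : Prop :=
  continuous r /\ r \o r = r.

Definition is_r_skeleton (X : topologicalType) d (G : porderType d)
    (r : G -> X -> X) : Prop :=
  [/\ forall s, retraction (r s),
      forall s, cosmic (set_type (range (r s))),
      forall s t, (s <= t)%O -> r s = r s \o r t /\ r s = r t \o r s,
      forall (u : nat -> G) (s : G), nondecreasing_seq u ->
        supremums (range u) s ->
        forall x, (fun n => r (u n) x) @ \oo --> r s x
    & forall x, (fun s => r s x) @ tails G --> x].

Definition admits_r_skeleton (X : topologicalType) : Prop :=
  exists (d : Order.disp_t) (G : porderType d) (r : G -> X -> X),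
    [/\ up_directed G, sigma_complete G & is_r_skeleton r].

Definition cube (R : realType) (T : Type) : set {ptws T -> R} :=
  [set x | forall t, 0 <= x t <= 1].
Arguments cube R T : clear implicits.

Definition coord_proj (R : realType) (T : Type) (A : set T)
    (x : {ptws T -> R}) : {ptws (set_type A) -> R} :=
  fun a => x (set_val a).
Arguments coord_proj {R T} A x.

Definition generate_pi_skeleton (R : realType) (T : Type)
    (Y : set {ptws T -> R}) d (G : porderType d)
    (F : G -> set {ptws T -> R}) (psi : G -> countable_sets T) : Prop :=
  [/\ forall s, F s `<=` Y /\ cosmic (set_type (F s)),
      omega_monotone psi,
      {homo F : s t / (s <= t)%O >-> s `<=` t},
      Y `<=` closure (\bigcup_s F s)
    & forall s,
        homeomorphism_onto_image (sigL (F s) (coord_proj (set_val (psi s)))) /\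
        coord_proj (set_val (psi s)) @` Y =
        coord_proj (set_val (psi s)) @` F s].

Definition has_pi_skeleton (R : realType) (T : Type)
    (Y : set {ptws T -> R}) : Prop :=
  exists (d : Order.disp_t) (G : porderType d)
      (F : G -> set {ptws T -> R}) (psi : G -> countable_sets T),
    [/\ up_directed G, sigma_complete G & generate_pi_skeleton Y F psi].

Definition admits_pi_skeleton (R : realType) (X : topologicalType) : Prop :=
  exists (T : Type) (Y : set {ptws T -> R}),
    [/\ Y `<=` cube R T,
        exists h : X -> set_type Y, homeomorphism h
      & has_pi_skeleton Y].

(* Main.v *)
Require Import Defs.
From HB Require Import structures.
From mathcomp Require Import all_boot all_order all_algebra.
From mathcomp Require Import all_classical all_reals all_analysis.
From mathcomp Require Import lra.
Import Order.TTheory GRing.Theory Num.Theory.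
Import numFieldNormedType.Exports.

(** The retractions of an r-skeleton and the sets of a pi-skeleton carry the
same information, once enough coordinates are fixed.

From a pi-skeleton to an r-skeleton, keep the index set G and let [r s x] be
the unique point of [F s] with the same coordinates in [psi s] as x; it exists
because [F s] and the whole space have the same projection, and it is unique
because the projection is injective on [F s]. Continuity of [r s], and the
convergence along increasing sequences, follow from one principle
([cvg_separated]): in a compact set, a net converges as soon as its images
under a separating family of continuous maps do. The pointwise convergence
[r s x --> x] is the only clause that is not formal, as the sets [psi s] need
not cover T and the union of the [F s] is only dense. It follows from a uniform
estimate ([coord_retr_near]): for each coordinate t and e > 0 some s satisfies
|x t - r s x t| <= e for every x. Otherwise there would be an increasing
sequence [u n] and points [x n] of [F (u n.+1)] such that [x n] and
[r (u n) (x n)] differ by more than e at t. Let s be the supremum of u. Along an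
ultrafilter, [x n] converges to a point z of the compact set [F s]; each
coordinate in [psi s] eventually lies in [psi (u n)], so that [r (u n) (x n)]
converges to z as well, a contradiction.

From an r-skeleton to a pi-skeleton, a cosmic subspace of a compact space has a
countable separating family [C s] of maps to [0, 1] ([cosmic_separating]). The
maps [f \o r s], with f in [C s], embed X in a cube with coordinates indexed by
pairs (s, f). Now [psi] has to be omega-monotone, and a given s may lie above
uncountably many indices; so G is replaced with the poset of its countable
directed subsets A, ordered by inclusion. With [sup A] in the role of s, let
[F A] be the image of [r (sup A)], and let [psi A] consist of the pairs (a, f)
with a in A and f in [C a]: unions of such A turn into unions of [psi A] by
construction. These coordinates do not distinguish x from [r (sup A) x], since
[r a \o r (sup A) = r a]; and they separate the points of [F A], because such a
point is the limit of its images under [r (b n)] for a sequence b in A with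
supremum [sup A] ([directed_sup]). *)

Set Implicit Arguments.
Unset Strict Implicit.
Unset Printing Implicit Defensive.

Local Open Scope classical_set_scope.
Local Open Scope ring_scope.

(** * Initial topologies, compactness and networks *)

Lemma cvg_initial (S : choiceType) (Z : topologicalType) (f : S -> Z)
    (F : set_system S) (s : S) : Filter F ->
  f @ F --> f s -> F --> (s : initial_topology f).
Proof.
move=> FF cvF U; rewrite nbhsE => -[V [[W oW <-] Ws] WU].
by apply: filterS WU _; apply: cvF; exact: open_nbhs_nbhs.
Qed.

Lemma cvg_set_type (X : topologicalType) (A : set X) (F : set_system A)
    (x : A) : Filter F -> set_val @ F --> set_val x -> F --> x.
Proof. exact: cvg_initial. Qed.

Lemma set_val_continuous (X : topologicalType) (A : set X) :
  continuous (set_val : A -> X).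
Proof. exact: initial_continuous. Qed.

Lemma continuous_set_type (W X : topologicalType) (A : set X) (f : W -> A) :
  continuous (set_val \o f) -> continuous f.
Proof. by move=> cf w; apply: cvg_set_type; exact: cf. Qed.

Lemma compact_set_type (X : topologicalType) (A : set X) :
  compact A -> compact [set: A].
Proof.
move=> cA F PF _; have FA : F (set_val @^-1` A).
  by apply: filterS filterT => a _; exact: set_valP.
have [x [Ax clx]] := cA (set_val @ F) _ FA.
exists (exist _ x (mem_set Ax)); split=> // B C FB.
rewrite nbhsE => -[D [[W oW <-] Wx] WC].
have [] := clx (set_val @` B) W.
- by apply: filterS (@preimage_image _ _ set_val B) FB.
- exact: open_nbhs_nbhs.
- by move=> _ [[b Bb <-] Wb]; exists b; split=> //; exact: WC.
Qed.

Lemma cvg_ptws (T : Type) (V : topologicalType) (F : set_system {ptws T -> V})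
    (f : {ptws T -> V}) : Filter F ->
  (forall t, g t @[g --> F] --> f t) -> F --> f.
Proof.
by move=> FF cvF; apply/cvg_sup => t; apply: cvg_initial; exact: cvF.
Qed.

Lemma eval_continuous (T : Type) (V : topologicalType) (t : T) :
  continuous (fun f : {ptws T -> V} => f t).
Proof.
move=> f U nU; have /cvg_sup/(_ t) : f --> f by apply: cvg_id.
apply; exact: (@initial_continuous _ _ (fun f : {ptws T -> V} => f t)).
Qed.

Lemma continuous_ptws (W : topologicalType) (T : Type) (V : topologicalType)
    (f : W -> {ptws T -> V}) :
  (forall t, continuous (fun w => f w t)) -> continuous f.
Proof. by move=> cf w; apply: cvg_ptws => t; exact: cf. Qed.

Lemma hausdorff_ptws (T : Type) (V : topologicalType) :
  hausdorff_space V -> hausdorff_space {ptws T -> V}.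
Proof.
move=> hV f g fg; apply: functional_extensionality_dep => t; apply: hV => A B.
move=> /(@eval_continuous T V t f) nA /(@eval_continuous T V t g) nB.
have [h [Ah Bh]] := fg _ _ nA nB.
by exists (h t).
Qed.

(** A net in a compact set E cannot accumulate at a point x of E other than y,
because some map of the family takes distinct values at x and y and converges
along u to its value at y; the compactness of E turns this into convergence. The map u may be a net, a sequence
or the inverse of a continuous bijection, which is why F is any filter. *)
Lemma cvg_separated (I T : Type) (X V : topologicalType) (F : set_system I)
    (u : I -> X) (E : set X) (A : set T) (phi : T -> X -> V) (y : X) :
    Filter F -> compact E -> hausdorff_space V ->
    (forall t, A t -> continuous (phi t)) ->
    (forall x, E x -> (forall t, A t -> phi t x = phi t y) -> x = y) ->
    (forall i, E (u i)) ->
    (forall t, A t -> phi t (u i) @[i --> F] --> phi t y) ->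
  u @ F --> y.
Proof.
move=> FF /compact_near_coveringP cE hV cphi sepE Eu cvu U nU.
have : \near F, E `<=` (fun x => u F = x -> U x).
  apply: cE => x Ex; have [->|xy] := pselect (x = y).
    by exists (U, setT) => [|[z i] [/= Uz _] _ //]; split=> //; exact: filterT.
  have [t At txy] : exists2 t, A t & phi t x <> phi t y.
    apply: contrapT => H; apply: xy; apply: sepE => // t At.
    by apply: contrapT => txy; apply: H; exists t.
  move: hV; rewrite open_hausdorff => /(_ _ _ (introN eqP txy)).
  case=> -[B C] /= [/set_mem Bx /set_mem Cy] [oB oC /eqP BC0].
  exists (phi t @^-1` B, u @^-1` (phi t @^-1` C)) => /=.
    split; first by apply: (cphi t At x); exact: open_nbhs_nbhs.
    by apply: (cvu t At); exact: open_nbhs_nbhs.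
  move=> [x' i] /= [Bx' Ci] uix'.
  have : (B `&` C) (phi t x') by split; rewrite // -uix'.
  by rewrite BC0.
by apply: filterS => i /(_ (u i) (Eu i)); exact.
Qed.

(** The inverse of f on its image is continuous at z by [cvg_separated], applied
to the separating family whose only member is f. *)
Lemma compact_embedding (K Z : topologicalType) (f : K -> Z) :
    compact [set: K] -> hausdorff_space Z -> continuous f -> injective f ->
  homeomorphism_onto_image f.
Proof.
move=> cK hZ cf injf.
have /choice[g gP] : forall z : range f, exists x, f x = set_val z.
  by move=> z; have [x _ fx] := set_valP z; exists x.
pose h x : range f := exist _ (f x) (mem_set (imageT f x)).
exists h; split=> //; split; first by apply: continuous_set_type; exact: cf.
exists g; split.
- move=> z; apply: (@cvg_separated _ unit _ _ _ _ setT setT (fun=> f)) => //.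
  + exact: nbhs_filter.
  + by move=> x _ /(_ tt I) /injf.
  + by move=> _ _; rewrite gP (funext gP); exact: set_val_continuous.
- by move=> x; apply: injf; rewrite gP.
- by move=> z; apply: val_inj; rewrite /= gP.
Qed.

(** The images of the members of a network form a network of the image. *)
Lemma cosmic_image (W X : topologicalType) (k : W -> X) (B : set X) :
  continuous k -> range k = B -> cosmic W -> cosmic (set_type B).
Proof.
move=> ck <-{B} [N cN netN].
pose k' w : range k := exist _ (k w) (mem_set (imageT k w)).
have ck' : continuous k' by exact: continuous_set_type.
exists [set k' @` C | C in N].
  exact: sub_countable (card_image_le _ _) cN.
move=> y U oU Uy; have [w _ kw] := set_valP y.
have Ey : k' w = y by apply: val_inj.
have oU' : open (k' @^-1` U) by apply: open_comp oU => x _; exact: ck'.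
have [|C NC [Cw CU]] := netN w _ oU'; first by rewrite /= Ey.
exists (k' @` C); first by exists C.
by split; [exists w | move=> _ [v Cv <-]; exact: CU].
Qed.

(** * Tails of a directed poset and suprema of families of sets *)

Lemma tails_filter d (G : porderType d) (s0 : G) :
  up_directed G -> ProperFilter (tails G).
Proof.
move=> dG; apply: filter_from_proper; last by move=> s _; exists s => /=.
apply: filter_from_filter; first by exists s0.
move=> s t _ _; have [u [su tu]] := dG s t; exists u => // v /= uv.
by split; [exact: le_trans su uv|exact: le_trans tu uv].
Qed.

(** Countable sets and countable directed sets are both ordered by inclusion and
closed under the unions at hand, so that suprema of sequences are unions. *)
Lemma supremums_bigcup d (S : porderType d) T (v : S -> set T) (u : nat -> S) :
    (forall a b, (a <= b)%O = (v a `<=` v b) :> Prop) ->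
    (exists c, v c = \bigcup_n v (u n)) ->
  forall b, supremums (range u) b <-> v b = \bigcup_n v (u n).
Proof.
move=> leE [c cU] b; split=> [[ubB lbB]|bU].
  apply/seteqP; split.
    rewrite -cU -leE; apply: lbB => _ [n _ <-].
    by rewrite leE cU; exact: bigcup_sup.
  by apply: bigcup_sub => n _; rewrite -leE; apply: ubB; exists n.
split=> [_ [n _ <-]|a ub_a]; rewrite leE bU; first exact: bigcup_sup.
by apply: bigcup_sub => n _; rewrite -leE; apply: ub_a; exists n.
Qed.

Definition countable_set_of T (A : set T) (cA : countable A) :
    countable_sets T :=
  exist _ A (mem_set (cA : [set B : set T | countable B] A)).

Lemma countable_sets_le T (A B : countable_sets T) :
  (A <= B)%O = (set_val A `<=` set_val B) :> Prop.
Proof. by rewrite -subsetEset. Qed.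

Lemma supremums_countable_sets T (v : nat -> countable_sets T)
    (B : countable_sets T) :
  supremums (range v) B <-> set_val B = \bigcup_n set_val (v n).
Proof.
have cU : countable (\bigcup_n set_val (v n)).
  by apply: bigcup_countable => // n _; exact: set_valP (v n).
apply: supremums_bigcup; first exact: countable_sets_le.
by exists (countable_set_of cU).
Qed.

(** * Retractions defined by coordinates *)

Section CoordinateRetractions.
(** A pi-skeleton read on X itself: [phi t] is the coordinate t of an embedding
of X in a cube, and [E s] corresponds to [F s]. *)
Context (R : realType) (X : topologicalType) (T : Type) (phi : T -> X -> R).
Context (X_compact : compact [set: X]).
Context (phi_cont : forall t, continuous (phi t)).
Context (phi_inj : forall x y, (forall t, phi t x = phi t y) -> x = y).
Context d (G : porderType d) (E : G -> set X) (psi : G -> set T).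
Context (G_directed : up_directed G).
Context (G_complete : sigma_complete G).
Context (E_compact : forall s, compact (E s)).
Context (E_cosmic : forall s, cosmic (set_type (E s))).
Context (E_homo : forall s t, (s <= t)%O -> E s `<=` E t).
Context (E_dense : forall x, closure (\bigcup_s E s) x).
Context (psi_homo : forall s t, (s <= t)%O -> psi s `<=` psi t).
Context (psi_sup : forall (u : nat -> G) s, nondecreasing_seq u ->
  supremums (range u) s -> psi s `<=` \bigcup_n psi (u n)).
Context (E_sep : forall s x y, E s x -> E s y ->
  (forall t, psi s t -> phi t x = phi t y) -> x = y).
Context (E_full : forall s x, exists2 y, E s y &
  forall t, psi s t -> phi t x = phi t y).

Definition coord_retr s x : X := s2val (cid2 (E_full s x)).
Local Notation r := coord_retr.

Lemma coord_retr_in s x : E s (r s x).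
Proof. exact: s2valP (cid2 (E_full s x)). Qed.

Lemma phi_coord_retr s x t : psi s t -> phi t (r s x) = phi t x.
Proof. by move=> st; rewrite (s2valP' (cid2 (E_full s x)) t st). Qed.

Lemma coord_retr_id s x : E s x -> r s x = x.
Proof.
move=> Ex; apply: (@E_sep s) => // [|t]; first exact: coord_retr_in.
exact: phi_coord_retr.
Qed.

Lemma range_coord_retr s : range (r s) = E s.
Proof.
apply/seteqP; split=> [_ [x _ <-]|x Ex]; first exact: coord_retr_in.
by exists x => //; exact: coord_retr_id.
Qed.

Lemma coord_retr_comp s t : (s <= t)%O -> r s \o r t = r s /\ r t \o r s = r s.
Proof.
move=> st; split; apply: funext => x /=; last first.
  by apply: coord_retr_id; apply: E_homo st _ _; exact: coord_retr_in.
apply: (@E_sep s); [exact: coord_retr_in|exact: coord_retr_in|move=> a sa].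
by rewrite !phi_coord_retr //; exact: psi_homo st _ _.
Qed.

Lemma cvg_coord_retr I (F : set_system I) (u : I -> X) s y : Filter F ->
    (forall i, E s (u i)) -> E s y ->
    (forall t, psi s t -> phi t (u i) @[i --> F] --> phi t y) ->
  u @ F --> y.
Proof.
move=> FF Eu Ey cvu.
apply: (@cvg_separated _ T _ R _ _ (E s) (psi s) phi) => //.
by move=> x Ex; exact: (@E_sep s).
Qed.

Lemma coord_retr_continuous s : continuous (r s).
Proof.
move=> x; apply: (@cvg_coord_retr _ _ _ s) => [y||t st];
  try exact: coord_retr_in.
rewrite phi_coord_retr // (_ : (fun y => phi t (r s y)) = phi t).
  exact: phi_cont.
by apply: funext => y; exact: phi_coord_retr.
Qed.

Lemma coord_retr_sup (u : nat -> G) s : nondecreasing_seq u ->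
  supremums (range u) s -> forall x, (fun n => r (u n) x) @ \oo --> r s x.
Proof.
move=> u_nd us x.
have u_s n : (u n <= s)%O by case: us => + _; apply; exists n.
apply: (@cvg_coord_retr _ _ _ s) => [n||t st]; try exact: coord_retr_in.
  by apply: E_homo (u_s n) _ _; exact: coord_retr_in.
have [n _ nt] := psi_sup u_nd us st.
rewrite phi_coord_retr //; apply: cvg_near_cst.
exists n => // m /= nm; rewrite phi_coord_retr //.
by apply: psi_homo nt; exact: u_nd.
Qed.

(** The bound is uniform in x, and therefore passes from the retraction [r s] to
all [r s'] with s <= s'. *)
Lemma coord_retr_near (s0 : G) t (e : R) : 0 < e ->
  exists s, forall x, `|phi t x - phi t (r s x)| <= e.
Proof.
move=> e0; apply: contrapT => H.
(* The failure of the bound at s is an open condition on x, so that density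
   provides a witness in some [E s'], where s' may be taken above s. *)
have /choice[f fP] s : exists xs : X * G,
    [/\ (s <= xs.2)%O, E xs.2 xs.1 & e < `|phi t xs.1 - phi t (r s xs.1)|].
  have [x ex] : exists x, e < `|phi t x - phi t (r s x)|.
    apply: contrapT => Hs; apply: H; exists s => x.
    by rewrite leNgt; apply/negP => lt; apply: Hs; exists x.
  have cvx : `|phi t y - phi t (r s y)| @[y --> x]
      --> `|phi t x - phi t (r s x)|.
    apply: cvg_norm; apply: cvgB; first exact: phi_cont.
    by apply: cvg_comp; [exact: coord_retr_continuous|exact: phi_cont].
  have [y [[s' _ Ey] ey]] := E_dense (cvgr_gt _ cvx _ ex).
  have [s'' [ss'' s's'']] := G_directed s s'.
  by exists (y, s''); split=> //=; exact: E_homo Ey.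
pose u n := iter n (fun s => (f s).2) s0.
pose x n := (f (u n)).1.
have u_nd : nondecreasing_seq u.
  by apply/nondecreasing_seqP => n; case: (fP (u n)).
have [s us] := G_complete u_nd.
have u_s n : (u n <= s)%O by case: us => + _; apply; exists n.
have Ex n : E s (x n).
  by have [_ Ex _] := fP (u n); apply: E_homo (u_s n.+1) _ Ex.
have [U [UU ooU]] := ultraFilterLemma (@eventually_filter).
have PU : ProperFilter U := @ultra_proper _ U UU.
have [z [Ez cvz]] : E s `&` [set z | x @ U --> z] !=set0.
  have [|z [Ez clz]] := @E_compact s (x @ U) (fmap_proper_filter x PU).
    by apply: (@filterE _ U) => n; exact: Ex.
  exists z; split=> // V nV; have [//|UCV] := in_ultra_setVsetC (x @^-1` V) UU.
  by have [y [nVy /nVy]] := clz (~` V) V UCV nV.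
(* A coordinate in [psi s] lies in [psi (u n)] from some n on, where [x n] and
   its retraction agree. *)
have cvrz : (fun n => r (u n) (x n)) @ U --> z.
  apply: (@cvg_coord_retr _ _ _ s) => // [n|a sa].
    by apply: E_homo (u_s n) _ _; exact: coord_retr_in.
  have cva : phi a (x n) @[n --> U] --> phi a z.
    exact: cvg_comp cvz (@phi_cont _ z).
  apply: cvg_trans cva; apply: near_eq_cvg.
  have [n _ na] := psi_sup u_nd us sa.
  apply: ooU; exists n => // m /= nm; rewrite phi_coord_retr //.
  by apply: psi_homo na; exact: u_nd.
have cv1 : phi t (x n) @[n --> U] --> phi t z.
  exact: cvg_comp cvz (@phi_cont _ z).
have cv2 : phi t (r (u n) (x n)) @[n --> U] --> phi t z.
  exact: cvg_comp cvrz (@phi_cont _ z).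
have : `|phi t (x n) - phi t (r (u n) (x n))| @[n --> U]
    --> `|phi t z - phi t z| by apply: cvg_norm; exact: cvgB.
rewrite subrr normr0 => /(cvgr_lt _) /(_ e e0) /filter_ex[n].
by case: (fP (u n)) => _ _ lt; rewrite ltNge (ltW lt).
Qed.

Lemma coord_retr_skeleton : is_r_skeleton r.
Proof.
split.
- move=> s; split; first exact: coord_retr_continuous.
  by apply: funext => x; apply: coord_retr_id; exact: coord_retr_in.
- by move=> s; rewrite range_coord_retr.
- by move=> s t /coord_retr_comp[-> ->].
- exact: coord_retr_sup.
move=> x; have [_ [[s0 _ _] _]] := E_dense (filterT : nbhs x setT).
have tF := tails_filter s0 G_directed.
apply: (@cvg_separated _ T _ R _ _ setT setT phi) => // [y _ sep|t _].
  by apply: phi_inj => t; apply: sep.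
apply/cvgrPdist_le => e e0.
have [s near_s] := coord_retr_near s0 t (divr_gt0 e0 (@ltr0Sn R 1)).
exists s => // s' /= ss'; apply: le_trans (ler_distD (phi t (r s x)) _ _) _.
(* [r s x] is also [r s (r s' x)], so that both terms are instances of the
   uniform bound at s. *)
rewrite [leRHS](splitr e) lerD //; have [rr _] := coord_retr_comp ss'.
by rewrite -rr /= distrC; exact: near_s.
Qed.

End CoordinateRetractions.

Lemma pi_skeleton_r_skeleton (R : realType) (X : topologicalType) :
  compact [set: X] -> admits_pi_skeleton R X -> admits_r_skeleton X.
Proof.
move=> X_compact [T [Y [_ [h [h_cont [g [g_cont hK gK]]]]]]].
move=> [d [G [F [psi [G_directed G_complete]]]]].
move=> [F_sub [psi_homo psi_sup] F_homo F_dense F_proj].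
exists d, G.
pose phi t x : R := set_val (h x) t.
pose E s : set X := [set x | F s (set_val (h x))].
pose inY s (p : F s) : Y :=
  exist _ (set_val p) (mem_set ((F_sub s).1 _ (set_valP p))).
have phi_cont t : continuous (phi t).
  have hx_cont : continuous (fun x => set_val (h x)).
    by move=> x; apply: cvg_comp; [exact: h_cont|exact: set_val_continuous].
  by move=> x; exact: cvg_comp (hx_cont x) (@eval_continuous T R t _).
have k_cont s : continuous (g \o @inY s).
  move=> p; apply: cvg_comp; last exact: g_cont.
  by apply: continuous_set_type; exact: set_val_continuous.
have k_range s : range (g \o @inY s) = E s.
  apply/seteqP; split=> [_ [p _ <-]|x Ex].
    by rewrite /E /= gK; exact: set_valP p.
  exists (exist _ (set_val (h x)) (mem_set (Ex : F s _))) => //=.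
  by rewrite -[RHS]hK; congr g; apply: val_inj.
have proj_inj s p q : F s p -> F s q ->
    (forall t, set_val (psi s) t -> p t = q t) -> p = q.
  move=> Fp Fq pq; have [[hf [[_ [gf [_ hfK _]]] hfE]] _] := F_proj s.
  pose p' : F s := exist _ p (mem_set Fp).
  pose q' : F s := exist _ q (mem_set Fq).
  suff : p' = q' by move=> /(congr1 set_val).
  apply: (can_inj hfK); apply: val_inj.
  rewrite -[LHS]/(set_val (hf p')) -[RHS]/(set_val (hf q')) !hfE.
  by apply: funext => t; apply: pq; exact: set_valP.
(* [F s] is homeomorphic to its projection, which is also the projection of the
   compact space. *)
have FsK s : compact [set: F s].
  have [[hf [[hf_cont [gf [gf_cont hfK gfK]]] hfE]] projE] := F_proj s.
  rewrite (_ : setT = range gf); last first.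
    by apply/seteqP; split=> // p _; exists (hf p).
  apply: continuous_compact; first exact: continuous_subspaceT.
  apply: compact_set_type.
  rewrite (_ : range _ =
      range (fun x => coord_proj (set_val (psi s)) (set_val (h x)))).
    apply: continuous_compact => //; apply: continuous_subspaceT.
    by apply: continuous_ptws => t; exact: phi_cont.
  transitivity (coord_proj (set_val (psi s)) @` F s).
    apply/seteqP; split=> [_ [p _ <-]|_ [p Fp <-]].
      by exists (set_val p) => //; exact: set_valP.
    by exists (exist _ p (mem_set Fp)).
  rewrite -projE; apply/seteqP; split=> [_ [p Yp <-]|_ [x _ <-]].
    by exists (g (exist _ p (mem_set Yp))) => //=; rewrite gK.
  by exists (set_val (h x)) => //; exact: set_valP.
have E_full s x : exists2 y, E s y &
    forall t, set_val (psi s) t -> phi t x = phi t y.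
  have [_ projE] := F_proj s.
  have : (coord_proj (set_val (psi s)) @` Y)
      (coord_proj (set_val (psi s)) (set_val (h x))).
    by exists (set_val (h x)) => //; exact: set_valP.
  rewrite projE => -[p Fp px]; pose p' : F s := exist _ p (mem_set Fp).
  exists (g (inY _ p')); first by rewrite /E /= gK.
  move=> t st; rewrite /phi gK.
  by have := congr1 (fun f => f (exist _ t (mem_set st))) px.
exists (coord_retr E_full); split=> //.
apply: coord_retr_skeleton => //.
- move=> x y xy; apply: (can_inj hK); apply: val_inj; apply: funext => t.
  exact: xy.
- move=> s; rewrite -k_range; apply: continuous_compact; last exact: FsK.
  by apply: continuous_subspaceT; exact: k_cont.
- move=> s; apply: cosmic_image (k_cont s) (k_range s) _.
  by have [] := F_sub s.
- by move=> s t st x; exact: F_homo.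
- move=> x V xV.
  have : nbhs (h x) (g @^-1` V) by apply: g_cont; rewrite hK.
  rewrite nbhsE => -[_ [[W oW <-] Wx] WV].
  have nW := open_nbhs_nbhs (conj oW Wx).
  have [p [[s _ Fp] Wp]] := F_dense _ (set_valP (h x)) W nW.
  exists (g (inY s (exist _ p (mem_set Fp)))); split; last exact: WV.
  by exists s => //; rewrite /E /= gK.
- by move=> s t /psi_homo; rewrite countable_sets_le.
- by move=> u s u_nd /(psi_sup _ _ u_nd)/supremums_countable_sets ->.
- move=> s x y Ex Ey xy; apply: (can_inj hK); apply: val_inj.
  exact: proj_inj Ex Ey _.
Qed.

(** * The poset of countable directed subsets *)

Definition countably_directed d (G : porderType d) : set (set G) :=
  [set A | [/\ countable A, A !=set0 &
    forall s t, A s -> A t -> exists w, [/\ A w, (s <= w)%O & (t <= w)%O]]].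

Definition directed_sets d (G : porderType d) : Type :=
  set_type (@countably_directed d G).

Definition directed_set_of d (G : porderType d) (A : set G)
  (dA : countably_directed A) : directed_sets G := exist _ A (mem_set dA).

HB.instance Definition _ d (G : porderType d) := SubChoice.on (directed_sets G).
HB.instance Definition _ d (G : porderType d) :=
  [SubChoice_isSubPOrder of directed_sets G by <: with set_display].

Lemma directed_sets_le d (G : porderType d) (A B : directed_sets G) :
  (A <= B)%O = (set_val A `<=` set_val B) :> Prop.
Proof. by rewrite -subsetEset. Qed.

(** Enumerate A by e, and take for [b n.+1] a bound in A of [b n] and
[e n.+1]. *)
Lemma directed_chain d (G : porderType d) (A : directed_sets G) :
  exists b : nat -> G, [/\ nondecreasing_seq b, forall n, set_val A (b n) &
    forall a, set_val A a -> exists n, (a <= b n)%O].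
Proof.
have [cA [a0 Aa0] dA] := set_valP A; set B := val A in cA Aa0 dA *.
case/pfcard_geP: cA => [B0|[e]]; first by move: Aa0; rewrite B0.
have /choice[up upP] : forall p : G * G, exists w, B p.1 -> B p.2 ->
    [/\ B w, (p.1 <= w)%O & (p.2 <= w)%O].
  move=> [s t] /=; have [[Bs Bt]|nB] := pselect (B s /\ B t).
    by have [w ?] := dA _ _ Bs Bt; exists w.
  by exists s => Bs Bt; case: nB.
pose b := fix b n := if n is m.+1 then up (b m, e m.+1) else e 0%N.
have Be n : B (e n) by exact: funS.
have Bb n : B (b n).
  elim: n => [|n IHn] /=; first exact: Be.
  by case: (upP (b n, e n.+1) IHn (Be n.+1)).
exists b; split=> //.
  apply/nondecreasing_seqP => n /=.
  by case: (upP (b n, e n.+1) (Bb n) (Be n.+1)).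
move=> a Ba; have [n _ <-] : (e @` setT) a by exact: surj.
exists n; case: n => [|n] //=.
by case: (upP (b n, e n.+1) (Bb n) (Be n.+1)).
Qed.

(** The supremum is reached along a sequence inside A, to which the continuity
of an r-skeleton along sequences applies. *)
Lemma directed_sup d (G : porderType d) (A : directed_sets G) :
    sigma_complete G ->
  exists s (b : nat -> G), [/\ supremums (set_val A) s, nondecreasing_seq b,
    forall n, set_val A (b n) & supremums (range b) s].
Proof.
move=> G_complete; have [b [b_nd Ab b_cof]] := directed_chain A.
have [s [ub_s lb_s]] := G_complete _ b_nd; exists s, b; split=> //; split.
  by move=> a /b_cof[n an]; apply: le_trans an _; apply: ub_s; exists n.
by move=> t ub_t; apply: lb_s => _ [n _ <-]; exact: ub_t.
Qed.

Lemma countable_setU T (A B : set T) :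
  countable A -> countable B -> countable (A `|` B).
Proof.
move=> cA cB; rewrite -bigcup2E; apply: bigcup_countable => // -[|[|n]] _ //=.
Qed.

(** The union of A and B is not directed in general; an upper bound w of both
repairs this, as it bounds every pair. *)
Lemma directed_sets_up_directed d (G : porderType d) :
  up_directed G -> sigma_complete G -> up_directed (directed_sets G).
Proof.
move=> G_directed G_complete A B.
have [a [_ [[ub_a _] _ _ _]]] := directed_sup A G_complete.
have [b [_ [[ub_b _] _ _ _]]] := directed_sup B G_complete.
have [w [aw bw]] := G_directed a b.
have ub_w s : (set_val A `|` set_val B `|` [set w]) s -> (s <= w)%O.
  case=> [[/ub_a sa|/ub_b sb]|->] //; [exact: le_trans aw|exact: le_trans bw].
have dC : countably_directed (set_val A `|` set_val B `|` [set w]).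
  split.
  - have [cA _ _] := set_valP A; have [cB _ _] := set_valP B.
    by apply: countable_setU; [exact: countable_setU|exact: countable1].
  - by exists w; right.
  - by move=> s t /ub_w sw /ub_w tw; exists w; split=> //; right.
exists (directed_set_of dC); rewrite !directed_sets_le.
by split=> s ?; left; [left|right].
Qed.

Lemma directed_sets_bigcup d (G : porderType d) (u : nat -> directed_sets G) :
  nondecreasing_seq u ->
  exists C : directed_sets G, set_val C = \bigcup_n set_val (u n).
Proof.
move=> u_nd.
have dU : countably_directed (\bigcup_n set_val (u n)).
  split.
  - by apply: bigcup_countable => // n _; case: (set_valP (u n)).
  - by have [_ [a ua] _] := set_valP (u 0%N); exists a, 0%N.
  - move=> s t [m _ us] [n _ ut].
    have := u_nd _ _ (leq_maxl m n); rewrite directed_sets_le => /(_ _ us) us'.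
    have := u_nd _ _ (leq_maxr m n); rewrite directed_sets_le => /(_ _ ut) ut'.
    have [_ _ /(_ _ _ us' ut')[w [uw sw tw]]] := set_valP (u (maxn m n)).
    by exists w; split=> //; exists (maxn m n).
by exists (directed_set_of dU).
Qed.

Lemma supremums_directed_sets d (G : porderType d) (u : nat -> directed_sets G)
    (A : directed_sets G) : nondecreasing_seq u ->
  supremums (range u) A <-> set_val A = \bigcup_n set_val (u n).
Proof.
move=> u_nd; apply: supremums_bigcup; first exact: directed_sets_le.
exact: directed_sets_bigcup.
Qed.

Lemma directed_sets_complete d (G : porderType d) :
  sigma_complete (directed_sets G).
Proof.
move=> u u_nd; have [C CU] := directed_sets_bigcup u_nd.
by exists C; apply/supremums_directed_sets.
Qed.

(** * Countable separating families *)

Definition unit_maps (R : realType) (X : topologicalType) : Type :=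
  set_type [set f : X -> R | continuous f /\ forall x, 0 <= f x <= 1].

Lemma unit_maps_separate (R : realType) (X : topologicalType) (x y : X) :
    compact [set: X] -> hausdorff_space X -> x <> y ->
  exists f : unit_maps R X, set_val f x = 0 /\ set_val f y = 1.
Proof.
move=> X_compact X_hausdorff xy.
have closed1 (z : X) : closed [set z].
  by apply: accessible_closed_set1; exact: hausdorff_accessible.
have xy0 : [set x] `&` [set y] = set0.
  by apply/seteqP; split=> // z [-> /xy].
have /(@uniform_separatorP _ R)[f [cf f01 fx fy]] :=
  normal_uniform_separator (compact_normal X_hausdorff X_compact)
    (closed1 x) (closed1 y) xy0.
have fP : [set f : X -> R | continuous f /\ forall x, 0 <= f x <= 1] f.
  by split=> // z; have := f01 _ (imageT f z); rewrite /= in_itv.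
exists (exist _ f (mem_set fP)); split.
  by apply: fx; exists x.
by apply: fy; exists y.
Qed.

(** For each pair (B, C) in the square of a countable network, keep one map that
is below 1/2 on B and above 1/2 on C, if there is any. Two distinct points x, y
are separated by a map f with values 0 and 1; the network has members around x
and y on which f is below, respectively above, 1/2, and the map kept for this
pair separates x from y. *)
Lemma cosmic_separating (R : realType) (X : topologicalType) (A : set X) :
    compact [set: X] -> hausdorff_space X -> cosmic (set_type A) ->
  exists C : set (unit_maps R X), countable C /\
    forall x y, A x -> A y -> x <> y ->
      exists2 f, C f & set_val f x <> set_val f y.
Proof.
move=> X_compact X_hausdorff [N cN netN].
pose splits (p : set A * set A) (f : unit_maps R X) :=
  p.1 `<=` [set a | set_val f (set_val a) < 2^-1] /\
  p.2 `<=` [set a | 2^-1 < set_val f (set_val a)].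
have /choice[D DP] : forall p, exists D : set (unit_maps R X), countable D /\
    forall f, splits p f -> exists2 g, D g & splits p g.
  move=> p; have [[f pf]|np] := pselect (exists f, splits p f).
    by exists [set f]; split=> [|_ _]; [exact: countable1|exists f].
  by exists set0; split=> [|f pf]; [exact: countable0|case: np; exists f].
exists (\bigcup_(p in N `*` N) D p); split.
  by apply: bigcup_countable => [|p _]; [exact: countableX|case: (DP p)].
move=> x y Ax Ay xy.
have [f [fx fy]] := @unit_maps_separate R X x y X_compact X_hausdorff xy.
have [cf _] := set_valP f.
have cfA : continuous (fun a : A => set_val f (set_val a)).
  by move=> a; apply: cvg_comp; [exact: set_val_continuous|exact: cf].
pose x' : A := exist _ x (mem_set Ax); pose y' : A := exist _ y (mem_set Ay).
have [B NB [Bx Bf]] : exists2 B, N B & B x' /\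
    B `<=` [set a | set_val f (set_val a) < 2^-1].
  apply: netN; first exact: open_comp (fun a _ => cfA a) (@open_lt R 2^-1).
  by rewrite /= fx invr_gt0.
have [C NC [Cy Cf]] : exists2 C, N C & C y' /\
    C `<=` [set a | 2^-1 < set_val f (set_val a)].
  apply: netN; first exact: open_comp (fun a _ => cfA a) (@open_gt R 2^-1).
  by rewrite /= fy; lra.
have [_ /(_ f (conj Bf Cf))[g Dg [Bg Cg]]] := DP (B, C).
exists g; first by exists (B, C).
move=> gxy; have := lt_trans (Bg _ Bx) (Cg _ Cy).
by rewrite /= gxy ltxx.
Qed.

(** * The pi-skeleton of an r-skeleton *)

Lemma r_skeleton_pi_skeleton (R : realType) (X : topologicalType) :
    compact [set: X] -> hausdorff_space X ->
  admits_r_skeleton X -> admits_pi_skeleton R X.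
Proof.
move=> X_compact X_hausdorff [d [G [r [G_directed G_complete]]]].
move=> [r_retr r_cosmic r_comp r_sup r_lim].
have r_cont s : continuous (r s) by case: (r_retr s).
have r_idem s x : range (r s) x -> r s x = x.
  by case=> z _ <-; have [_ /(congr1 (@^~ z))] := r_retr s.
have /choice[C CP] s :=
  @cosmic_separating R X _ X_compact X_hausdorff (r_cosmic s).
have C_sep s x y : r s x <> r s y ->
    exists2 f, C s f & set_val f (r s x) <> set_val f (r s y).
  by move=> rxy; have [_ sepC] := CP s; apply: sepC => //; exact: imageT.
have /choice[sup supP] (A : directed_sets G) := directed_sup A G_complete.
have le_sup (A : directed_sets G) a : set_val A a -> (a <= sup A)%O.
  by move=> Aa; have [_ [[ub _] _ _ _]] := supP A; exact: ub.
pose T : Type := (G * unit_maps R X)%type.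
pose e x : {ptws T -> R} := fun p => set_val p.2 (r p.1 x).
have e_cont : continuous e.
  apply: continuous_ptws => -[s f] x; have [f_cont _] := set_valP f.
  by apply: cvg_comp; [exact: r_cont|exact: f_cont].
pose psi_set (A : directed_sets G) : set T :=
  [set p | set_val A p.1 /\ C p.1 p.2].
have psi_countable A : countable (psi_set A).
  have -> : psi_set A = \bigcup_(a in set_val A) [set (a, f) | f in C a].
    apply/seteqP; split=> [[a f] [/= Aa Cf]|_ [a Aa [f Cf <-]] //].
    by exists a => //; exists f.
  have [A_countable _ _] := set_valP A.
  apply: bigcup_countable => // a _.
  by apply: sub_countable (card_image_le _ _) _; case: (CP a).
pose psi A := countable_set_of (psi_countable A).
pose F (A : directed_sets G) : set {ptws T -> R} := e @` range (r (sup A)).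
(* Points of the image of [r (sup A)] are the limits of their images under
   [r (b n)], where b is a sequence in A with supremum [sup A]. *)
have F_inj A x y : range (r (sup A)) x -> range (r (sup A)) y ->
    (forall p, psi_set A p -> e x p = e y p) -> x = y.
  move=> Fx Fy exy; apply: contrapT => xy.
  have [b [_ b_nd Ab b_sup]] := supP A.
  have cvb z : range (r (sup A)) z -> (fun n => r (b n) z) @ \oo --> z.
    by move=> Fz; rewrite -[X in _ --> X](r_idem _ _ Fz); exact: r_sup.
  have [n rxy] : exists n, r (b n) x <> r (b n) y.
    apply: contrapT => nn; apply: xy.
    apply: (cvg_unique X_hausdorff (cvb _ Fx)).
    rewrite (_ : (fun n => r (b n) x) = (fun n => r (b n) y)); first exact: cvb.
    by apply: funext => n; apply: contrapT => rxy; apply: nn; exists n.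
  have [f Cf fxy] := C_sep _ _ _ rxy.
  by apply: fxy; exact: (exy (b n, f) (conj (Ab n) Cf)).
have e_inj : injective e.
  move=> x y exy; have [s0 _ _] := r_lim x _ (filterT : nbhs x setT).
  have tF := tails_filter s0 G_directed.
  apply: (cvg_unique X_hausdorff (r_lim x)).
  rewrite (_ : r^~ x = r^~ y); first exact: r_lim.
  apply: funext => s; apply: contrapT => /C_sep[f _ fxy].
  by apply: fxy; have := congr1 (@^~ (s, f)) exy.
exists T, (range e); split.
- by move=> _ [x _ <-] [s f]; have [_] := set_valP f; apply.
- have [|h [h_homeo _]] := compact_embedding X_compact _ e_cont e_inj.
    by apply: hausdorff_ptws; exact: Rhausdorff.
  by exists h.
exists set_display, (directed_sets G), F, psi; split.
- exact: directed_sets_up_directed.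
- exact: directed_sets_complete.
split.
- move=> A; split; first by move=> _ [x _ <-]; exists x.
  apply: (cosmic_image (k := e \o set_val)) (r_cosmic (sup A)).
    by move=> x; apply: cvg_comp; [exact: set_val_continuous|exact: e_cont].
  apply/seteqP; split=> [_ [x _ <-]|_ [x Fx <-]].
    by exists (set_val x) => //; exact: set_valP.
  by exists (exist _ x (mem_set Fx)).
- split=> [A B|u A u_nd].
    by rewrite directed_sets_le countable_sets_le => AB p [/AB].
  move=> /(supremums_directed_sets _ u_nd) AU; apply/supremums_countable_sets.
  apply/seteqP; split=> [[a f] [/= Aa Cf]|[a f] [n _ [/= ua Cf]]].
    by move: Aa; rewrite AU => -[n _ ua]; exists n.
  by split=> //=; rewrite AU; exists n.
- move=> A B; rewrite directed_sets_le => AB _ [x Fx <-]; exists x => //.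
  have AB' : (sup A <= sup B)%O.
    by have [_ [[_ lub] _ _ _]] := supP A; apply: lub => a /AB; exact: le_sup.
  exists x => //; have [_ rBA] := r_comp _ _ AB'.
  rewrite -{1}(r_idem _ _ Fx) -[LHS]/((r (sup B) \o r (sup A)) x).
  by rewrite -rBA r_idem.
- move=> _ [x _ <-] V /e_cont /(r_lim x) [s0 _ s0V].
  have d0 : countably_directed [set s0].
    split; [exact: countable1|by exists s0|].
    by move=> _ _ -> ->; exists s0.
  exists (e (r (sup (directed_set_of d0)) x)); split.
    exists (directed_set_of d0) => //.
    by exists (r (sup (directed_set_of d0)) x).
  by apply: s0V; exact: (le_sup (directed_set_of d0) s0 erefl).
move=> A; split.
  apply: compact_embedding.
  - apply: compact_set_type; apply: continuous_compact.
      exact: continuous_subspaceT.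
    by apply: continuous_compact => //; exact: continuous_subspaceT.
  - by apply: hausdorff_ptws; exact: Rhausdorff.
  - apply: continuous_ptws => t p.
    exact: cvg_comp (@set_val_continuous _ (F A) p)
      (@eval_continuous T R (set_val t) _).
  move=> p q pq; apply: val_inj.
  have [x Fx xp] := set_valP p; have [y Fy yq] := set_valP q.
  rewrite -xp -yq; congr e.
  apply: F_inj Fx Fy _ => t At; rewrite xp yq.
  by have := congr1 (fun f => f (exist _ t (mem_set At))) pq.
apply/seteqP; split=> [_ [_ [x _ <-] <-]|_ [_ [x _ <-] <-]].
  exists (e (r (sup A) x)); first by exists (r (sup A) x).
  apply: funext => -[[a f] /= Af]; rewrite /coord_proj /e /=.
  have [/le_sup aA _] := set_mem Af.
  by have [/(congr1 (@^~ x)) /= <- _] := r_comp _ _ aA.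
by exists (e x).
Qed.

Theorem theorem5p9 (R : realType) (X : topologicalType)
    (X_compact : compact [set: X]%classic) (X_hausdorff : hausdorff_space X) :
  admits_r_skeleton X <-> admits_pi_skeleton R X.
Proof.
split; first exact: r_skeleton_pi_skeleton.
exact: pi_skeleton_r_skeleton.
Qed.
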